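(* Let $f(n,k)$ denote the number of standard Young tableaux with $n$ cells whose entry in row $1$, column $2$ is $k$, and let $t_m$ denote the number of involutions of $[m]$ (with $t_0=1$ and $t_m=0$ for $m<0$). Then for $1\le k\le n$, \[f(n,k)=\sum_{j=0}^{k-1}\binom{n-k}{k-j-1}t_{n-2k+j+2}-\binom{n-k}{k-1}t_{n-2k+1}-\binom{n-k}{k}t_{n-2k},\] where $\binom{a}{b}=0$ if $b>a$ or $b<0$.
   Context: $t_m$ also equals the number of standard Young tableaux with $m$ cells. A standard Young tableau with $n$ cells is a Ferrers diagram of a partition of $n$ filled bijectively with $1,\dots,n$, entries increasing along rows and down columns. *)

(* Defs.v *)
From mathcomp Require Import all_boot all_order all_algebra all_fingroup.
Set Implicit Arguments. Unset Strict Implicit. Unset Printing Implicit Defensive.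
Import GRing.Theory Num.Theory.

(* A standard Young tableau with n cells is encoded by the map
   pos : 'I_n -> 'I_n * 'I_n sending entry v (standing for the label v+1)
   to its cell (row, column), both 0-indexed.  A diagram with n cells
   has fewer than n rows and fewer than n columns, so 'I_n suffices. *)
Definition cell (n : nat) := ('I_n * 'I_n)%type.

Definition is_SYT (n : nat) (pos : {ffun 'I_n -> cell n}) : bool :=
  injectiveb pos &&
  [forall v, forall c : cell n,
     ((c.1 <= (pos v).1)%N && (c.2 <= (pos v).2)%N) ==> (c \in codom pos)] &&
  [forall a, forall b,
     (((pos a).1 == (pos b).1) && ((pos a).2.+1 == (pos b).2)) ==> (a < b)%N] &&
  [forall a, forall b,
     (((pos a).2 == (pos b).2) && ((pos a).1.+1 == (pos b).1)) ==> (a < b)%N].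

Definition entry12 (n k : nat) (pos : {ffun 'I_n -> cell n}) : bool :=
  [exists v : 'I_n, [&& val (pos v).1 == 0%N, val (pos v).2 == 1%N & v.+1 == k]].

Definition f (n k : nat) : nat :=
  #|[set pos : {ffun 'I_n -> cell n} | is_SYT pos && entry12 k pos]|.

Definition invol (m : nat) : nat := #|[set s : 'S_m | [forall i, s (s i) == i]]|.

Definition t (m : int) : int :=
  match m with Posz m' => (invol m')%:Z | Negz _ => 0%R end.

Definition binz (a b : int) : int :=
  match a, b with Posz a', Posz b' => ('C(a', b'))%:Z | _, _ => 0%R end.

(* Main.v *)
(* Reading off the row of each entry turns a tableau into a lattice word, i.e. a
   path in Young's lattice starting from the empty shape.  The entry in row 1,
   column 2 is [k >= 2] exactly when the path goes down the first column for
   [k - 1] steps and then reaches the shape (2, 1^(k-2)).  The number of paths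
   of length [N] leaving a shape [mu] satisfies
     c (N+1) mu = c N mu + N c (N-1) mu + \sum_(mu' below mu) c N mu',
   which follows by induction on [N] from the fact that every shape has one more
   upper than lower neighbour.  For [mu = 1^m], together with the recurrence
   t (m+1) = t m + m t (m-1), this gives
     c N 1^m = \sum_(a <= m) 'C(N, a) t (N - a).
   Since 1^(k-1) is covered by 1^k and (2, 1^(k-2)) only, f(n, k) is the difference
   c (n-k+1) 1^(k-1) - c (n-k) 1^k, and Pascal's rule simplifies it. *)
Require Import Defs.
From mathcomp Require Import all_boot all_order all_algebra all_fingroup.
From mathcomp Require Import zify.
Import GRing.Theory Num.Theory.

Set Implicit Arguments. Unset Strict Implicit. Unset Printing Implicit Defensive.
Local Open Scope nat_scope.

(** * The recurrence for the number of involutions *)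

Fixpoint invol_rec n :=
  match n with
  | 0 => 1
  | 1 => 1
  | (n'.+1 as m).+1 => invol_rec m + m * invol_rec n'
  end.

(** Restricting the support inside one fixed type lets the induction run on [#|A|] without moving
    between symmetric groups. *)
Definition invol_on (T : finType) (A : {set T}) :=
  [set s : {perm T} | perm_on A s & [forall i, s (s i) == i]].

Lemma invol_onP (T : finType) (A : {set T}) (s : {perm T}) :
  reflect ((forall i, s i != i -> i \in A) /\ involutive s) (s \in invol_on A).
Proof.
rewrite inE; apply: (iffP andP) => -[sA sK]; split.
- by move=> i si; apply: (subsetP sA).
- by move=> i; apply/eqP/(forallP sK).
- by apply/subsetP => i; rewrite inE; apply: sA.
- by apply/forallP => i; rewrite sK.
Qed.

Lemma invol_on_fix (T : finType) (A : {set T}) x : x \in A ->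
  [set s in invol_on A | s x == x] = invol_on (A :\ x).
Proof.
move=> Ax; apply/setP => s; rewrite inE; apply/andP/invol_onP.
  move=> [/invol_onP[sA sK] /eqP sx]; split=> // i si.
  by rewrite !inE sA // andbT; apply: contraNneq si => ->; rewrite sx.
move=> [sA sK]; split; last by apply: contraT => /sA; rewrite !inE eqxx.
by apply/invol_onP; split=> // i /sA; rewrite !inE => /andP[].
Qed.

(** Multiplying by [tperm x y] deletes or restores the 2-cycle formed by [x] and [y]. *)
Lemma invol_on_swap (T : finType) (A : {set T}) x y : x \in A -> y \in A -> y != x ->
  [set s in invol_on A | s x == y] =
  [set (tperm x y * s)%g | s in invol_on (A :\ x :\ y)].
Proof.
move=> Ax Ay yx; apply/setP => s; rewrite inE; apply/andP/imsetP.
  move=> [/invol_onP[sA sK] /eqP sx]; exists (tperm x y * s)%g; last first.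
    by rewrite mulgA tperm2 mul1g.
  have sy : s y = x by rewrite -sx sK.
  apply/invol_onP; split=> i; rewrite !permM; last first.
    case: (tpermP x y i) => [->|->|ix iy]; rewrite ?sx ?sy ?tpermL ?tpermR //.
    rewrite tpermD ?sK //.
      by apply: contra_notN iy => /eqP x_si; rewrite -(sK i) -x_si sx.
    by apply: contra_notN ix => /eqP y_si; rewrite -(sK i) -y_si sy.
  case: (tpermP x y i) => [->|->|ix iy]; rewrite ?sx ?sy ?eqxx // => /sA.
  by rewrite !inE => ->; move: ix iy => /eqP -> /eqP ->.
move=> [u /invol_onP[uA uK] ->].
have ux : u x = x by apply: contraTeq isT => /uA; rewrite !inE eqxx andbF.
have uy : u y = y by apply: contraTeq isT => /uA; rewrite !inE eqxx.
rewrite permM tpermL uy; split=> //.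
apply/invol_onP; split=> i; rewrite !permM.
  case: (tpermP x y i) => [->|->|ix iy] //.
  by move/uA; rewrite !inE => /and3P[].
case: (tpermP x y i) => [->|->|/eqP ix /eqP iy]; rewrite ?ux ?uy ?tpermL ?tpermR //.
rewrite tpermD ?uK //.
  by apply: contra_neq ix => x_ui; rewrite -(uK i) -x_ui.
by apply: contra_neq iy => y_ui; rewrite -(uK i) -y_ui.
Qed.

(** Sort the involutions by the image of a chosen [x] in [A]: fixing [x] frees the [#|A| - 1] other
    points, and each image [y != x] leaves [#|A| - 2] points. *)
Lemma card_invol_on (T : finType) (A : {set T}) : #|invol_on A| = invol_rec #|A|.
Proof.
have [m leAm] := ubnP #|A|; elim: m A leAm => // m IH A.
case: (set_0Vmem A) => [->|[x Ax]] leAm.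
  rewrite cards0 /= -(cards1 (1%g : {perm T})); apply: eq_card => s.
  rewrite inE; apply/invol_onP/eqP => [[s0 _]|->]; last first.
    by split=> i; rewrite !perm1 ?eqxx.
  by apply/permP => i; rewrite perm1; apply/eqP; apply: contraT => /s0; rewrite inE.
have -> : #|invol_on A| = \sum_(y in A) #|[set s in invol_on A | s x == y]|.
  rewrite -sum1_card (partition_big (fun s : {perm T} => s x) (mem A)) /=.
    by apply: eq_bigr => y _; rewrite -sum1_card; apply: eq_bigl => s; rewrite [in RHS]inE.
  move=> s /invol_onP[sA sK]; have [->//|sx] := eqVneq (s x) x.
  by apply: sA; rewrite sK eq_sym.
rewrite (bigD1 x) //= invol_on_fix // IH; last by move: leAm; rewrite (cardsD1 x A) Ax; lia.
have := cardsD1 x A; rewrite Ax add1n => cardA; rewrite cardA.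
case cardAx : #|A :\ x| cardA leAm => [|p] cardA leAm.
  rewrite big1 // => y /andP[Ay yx]; move: cardAx.
  by rewrite (cardsD1 y) !inE Ay yx.
rewrite (eq_bigr (fun=> invol_rec p)); last first.
  move=> y /andP[Ay yx]; rewrite invol_on_swap // card_imset; last exact: mulgI.
  have := cardsD1 y (A :\ x); rewrite cardAx !inE Ay yx add1n => -[cardE].
  by rewrite IH -?cardE //; lia.
rewrite sum_nat_const; congr (_ + _ * _); rewrite -cardAx.
by apply: eq_card => y; rewrite !inE andbC.
Qed.

Lemma involE m : invol m = invol_rec m.
Proof.
rewrite -[in RHS](card_ord m) -cardsT -card_invol_on; apply: eq_card => s.
rewrite [LHS]inE; apply/forallP/invol_onP => [sK|[_ sK] i]; last by rewrite sK.
by split=> i; [rewrite inE | apply/eqP].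
Qed.

Lemma invol0 : invol 0 = 1. Proof. by rewrite involE. Qed.

Lemma involS m : invol m.+1 = invol m + m * invol m.-1.
Proof. by rewrite !involE; case: m. Qed.

(** * Paths in Young's lattice *)

Definition incr (mu : nat -> nat) r : nat -> nat := fun s => mu s + (s == r).
Definition decr (mu : nat -> nat) r : nat -> nat := fun s => mu s - (s == r).
(** Shapes are functions giving row lengths, with rows numbered from 0. For nonincreasing [mu],
    [addable] and [removable] locate the outer and inner corners. *)
Definition addable (mu : nat -> nat) r := (r == 0) || (mu r < mu r.-1).
Definition removable (mu : nat -> nat) r := mu r.+1 < mu r.

(* Only rows below [B] may grow, so this counts all paths only if [mu] has
   at most [B - N] nonempty rows. *)
Fixpoint growths B N (mu : nat -> nat) : nat :=
  if N is N'.+1 then \sum_(r < B | addable mu r) growths B N' (incr mu r) else 1.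

Lemma eq_growths B N mu nu : mu =1 nu -> growths B N mu = growths B N nu.
Proof.
elim: N mu nu => //= N IH mu nu eq_mu.
apply: eq_big => [r|r _]; first by rewrite /addable !eq_mu.
by apply: IH => s; rewrite /incr eq_mu.
Qed.

Lemma incr_partition mu r :
  (forall s, mu s.+1 <= mu s) -> addable mu r -> forall s, incr mu r s.+1 <= incr mu r s.
Proof.
move=> mu_part; rewrite /addable /incr => add_r s; have := mu_part s.
case: (eqVneq s.+1 r) add_r => [<-|_] /=; case: (eqVneq s r) => ?; lia.
Qed.

(** Row [r.+1] is addable exactly when row [r] is removable; row 0 is always addable and accounts
    for the extra one. *)
Lemma sum_addable B mu : mu B = 0 ->
  \sum_(r < B.+1 | addable mu r) 1 = (\sum_(r < B.+1 | removable mu r) 1).+1.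
Proof.
move=> mu0; rewrite big_mkcond big_ord_recl /= add1n; congr _.+1.
by rewrite [RHS]big_mkcond big_ord_recr /= /removable mu0 addn0.
Qed.

(** The two moves interact only for [r = s.+1], and then either order requires
    [mu r + 2 <= mu s]. *)
Lemma addable_removable_swap mu r s : r != s ->
  addable mu r && removable (incr mu r) s = removable mu s && addable (decr mu s) r.
Proof.
rewrite /addable /removable /incr /decr => /negPf rs.
rewrite eq_sym in rs; rewrite rs; case: r rs => [|r] rs /=; first by lia.
rewrite eqSS (eq_sym r.+1) rs (eq_sym s); case: (eqVneq r s) => [->|_]; lia.
Qed.

(* The terms with [r != s] match by [addable_removable_swap]; the diagonal ones differ
   by one, by [sum_addable]: this is [DU - UD = 1] for the up and down operators. *)
Lemma growthsS B N mu :
  (forall s, mu s.+1 <= mu s) -> (forall s, B <= s + N.+1 -> mu s = 0) -> N < B ->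
  growths B N.+1 mu =
    growths B N mu + N * growths B N.-1 mu
    + \sum_(s < B | removable mu s) growths B N (decr mu s).
Proof.
elim: N mu => [|N IH] mu mu_part mu0 ltNB.
  case: B mu0 ltNB => // B mu0 _; rewrite [LHS]sum_addable ?add1n //.
  by apply: mu0; lia.
rewrite [LHS]/=.
have diagE (r : 'I_B) : growths B N (decr (incr mu r) r) = growths B N mu.
  by apply: eq_growths => s; rewrite /decr /incr; lia.
(* The induction hypothesis is applied to each [incr mu r], and the term [s = r], where the removal
   undoes the addition, is split off. *)
transitivity (\sum_(r < B | addable mu r)
   (growths B N (incr mu r) + N * growths B N.-1 (incr mu r)
    + growths B N mu
    + \sum_(s < B | (r != s) && removable (incr mu r) s) growths B N (decr (incr mu r) s))).
  apply: eq_bigr => r add_r.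
  rewrite [LHS]IH; first 1 last.
  - exact: incr_partition.
  (* A cell can start row [s > 0] only below a nonempty row [s.-1], but that row is also in the
     range where [mu] vanishes. *)
  - move=> s leB; rewrite /incr mu0; last lia.
    case: eqP => // sr; move: add_r; rewrite /addable.
    have [r0|r0] := eqVneq (nat_of_ord r) 0; first by lia.
    rewrite /= (mu0 r.-1) //; move: sr; lia.
  - lia.
  rewrite (bigD1 r) /=; last first.
    have := mu_part r; rewrite /removable /incr; case: eqP; lia.
  rewrite diagE addnA; congr (_ + _); apply: eq_bigl => s.
  by rewrite andbC eq_sym.
rewrite !big_split /=.
have -> : \sum_(r < B | addable mu r) N * growths B N.-1 (incr mu r) = N * growths B N mu.
  by case: (N) => [|N']; [rewrite big1 | rewrite -big_distrr].
have -> : \sum_(r < B | addable mu r) growths B N mu =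
          growths B N mu * (\sum_(s < B | removable mu s) 1).+1.
  have mu0' : mu B.-1 = 0 by apply: mu0; lia.
  case: (B) mu0' ltNB => // B' /sum_addable <- _.
  by rewrite big_distrr /=; apply: eq_bigr => r _; rewrite muln1.
have -> : \sum_(s < B | removable mu s) \sum_(r < B | addable (decr mu s) r)
     growths B N (incr (decr mu s) r) =
   growths B N mu * \sum_(s < B | removable mu s) 1
   + \sum_(s < B | removable mu s) \sum_(r < B | (r != s) && addable (decr mu s) r)
      growths B N (incr (decr mu s) r).
  rewrite big_distrr -big_split /=; apply: eq_bigr => s rem_s.
  rewrite (bigD1 s) /=; last first.
    move: rem_s; rewrite /removable /addable /decr eqxx.
    case: (nat_of_ord s) => //= s'; have := mu_part s'; lia.
  rewrite muln1; congr (_ + _); last by apply: eq_bigl => r; rewrite andbC.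
  apply: eq_growths => r; move: rem_s; rewrite /removable /incr /decr.
  case: eqVneq => [->|_]; lia.
have -> : \sum_(r < B | addable mu r)
    \sum_(s < B | (r != s) && removable (incr mu r) s) growths B N (decr (incr mu r) s)
  = \sum_(s < B | removable mu s) \sum_(r < B | (r != s) && addable (decr mu s) r)
      growths B N (incr (decr mu s) r).
  rewrite (exchange_big_dep xpredT) //= [RHS]big_mkcond /=.
  apply: eq_bigr => s _; case: ifPn => rem_s; last first.
    apply: big_pred0 => r; case: (eqVneq r s) => [_|rs]; first by rewrite andbF.
    by rewrite /= addable_removable_swap // (negPf rem_s).
  apply: eq_big => [r|r /and3P[_ rs _]].
    case: (eqVneq r s) => [_|rs]; first by rewrite andbF.
    by rewrite /= addable_removable_swap // rem_s.
  apply: eq_growths => u; rewrite /incr /decr.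
  have := rs; rewrite -val_eqE /=; lia.
rewrite mulnS; lia.
Qed.

(** * Paths leaving a one-column shape *)

Definition column m r : nat := r < m.

(** The only removable cell of a nonempty column is its last one, so the sum over lower neighbours
    has at most one term. *)
Lemma growths_columnS B N m : N.+1 + m <= B ->
  growths B N.+1 (column m) =
    growths B N (column m) + N * growths B N.-1 (column m)
    + (if m is m'.+1 then growths B N (column m') else 0).
Proof.
move=> leB; rewrite growthsS; last lia.
- congr (_ + _); case: m leB => [|m] leB.
    by rewrite big_pred0.
  have ltmB : m < B by lia.
  rewrite (big_pred1 (Ordinal ltmB)) => [|r].
    by apply: eq_growths => s; rewrite /decr /column /=; lia.
  by rewrite /removable /column /= -val_eqE /=; lia.
- by move=> s; rewrite /column; lia.
- by move=> s; rewrite /column; lia.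
Qed.

Lemma sum_bin_invol_pascal N m :
  \sum_(a < m.+1) 'C(N.+1, a) * invol (N.+1 - a) =
    \sum_(a < m.+1) 'C(N, a) * invol (N.+1 - a) + \sum_(a < m) 'C(N, a) * invol (N - a).
Proof.
rewrite big_ord_recl [in RHS]big_ord_recl !bin0 -addnA -big_split /=; congr (_ + _).
by apply: eq_bigr => a _; rewrite /bump /= add1n binS mulnDl subSS.
Qed.

(** Both sides obey the same recurrence: Pascal's rule splits off the sum for [m - 1], and the rest
    follows termwise from [involS] and the absorption identity
    [N * 'C(N.-1, a) = (N - a) * 'C(N, a)]. *)
Lemma growths_columnE B N m : N + m <= B ->
  growths B N (column m) = \sum_(a < m.+1) 'C(N, a) * invol (N - a).
Proof.
have [p] := ubnP (N + m); elim: p N m => // p IH [|N] m ltp leB.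
  rewrite big_ord_recl big1 => [|a _]; last by rewrite bin0n.
  by rewrite bin0 invol0.
rewrite growths_columnS // IH; [|lia|lia].
have -> : N * growths B N.-1 (column m) = \sum_(a < m.+1) N * 'C(N.-1, a) * invol (N.-1 - a).
  case: N ltp leB => [|N] ltp leB; first by rewrite big1.
  by rewrite IH; [|lia|lia]; rewrite big_distrr; apply: eq_bigr => a _ /=; rewrite mulnA.
have -> : (if m is m'.+1 then growths B N (column m') else 0) =
          \sum_(a < m) 'C(N, a) * invol (N - a).
  case: m ltp leB => [|m] ltp leB; first by rewrite big_ord0.
  by rewrite IH //; lia.
rewrite sum_bin_invol_pascal.
rewrite -big_split /=; congr (_ + _); apply: eq_bigr => a _.
(* For [a > N] the subtractions are truncated, but the binomials vanish. *)
have [leaN|ltNa] := leqP a N; last by rewrite !bin_small ?muln0; lia.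
rewrite subSn // involS mulnDr; congr (_ + _); rewrite mul_bin_down [(N - a) * _]mulnC -mulnA.
by congr (_ * (_ * invol _)); lia.
Qed.

(** * Lattice words *)

(** A word lists the rows that receive the successive cells, starting from [mu]. From the empty
    shape these are the Yamanouchi words. *)
Fixpoint lattice (mu : nat -> nat) (w : seq nat) : bool :=
  if w is r :: w' then addable mu r && lattice (incr mu r) w' else true.

Lemma eq_lattice mu nu w : mu =1 nu -> lattice mu w = lattice nu w.
Proof.
elim: w mu nu => //= r w IH mu nu eq_mu; congr (_ && _).
  by rewrite /addable !eq_mu.
by apply: IH => s; rewrite /incr eq_mu.
Qed.

Definition words B N mu (P : pred (seq nat)) :=
  [set w : N.-tuple 'I_B | lattice mu (map val w) && P (map val w)].

Lemma eq_words B N mu nu P Q : mu =1 nu -> P =1 Q -> words B N mu P = words B N nu Q.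
Proof. by move=> eq_mu eq_P; apply/setP => w; rewrite !inE (eq_lattice _ eq_mu) eq_P. Qed.

Lemma card_wordsS B N mu P :
  #|words B N.+1 mu P| =
    \sum_(r < B | addable mu r) #|words B N (incr mu r) (fun w => P (val r :: w))|.
Proof.
rewrite -sum1_card (partition_big (@thead _ _) (fun r : 'I_B => addable mu r)) /=; last first.
  by case/tupleP=> r w; rewrite inE theadE => /andP[/andP[]].
apply: eq_bigr => r add_r.
have cons_inj : injective (fun w : N.-tuple 'I_B => cons_tuple r w).
  by move=> u v /(congr1 val) [] /val_inj.
rewrite -(card_imset _ cons_inj) -sum1_card; apply: eq_bigl => w.
apply/andP/imsetP => [[]|[u]].
  case/tupleP: w => x w; rewrite theadE inE => lw /eqP xr; exists w.
    by move: lw; rewrite xr inE /= add_r.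
  by apply: val_inj; rewrite xr.
by rewrite inE => lu ->; rewrite theadE inE /= add_r eqxx.
Qed.

(** The shape reached after [i] letters is [mu] plus the letter counts of the prefix. *)
Lemma latticeP mu w :
  reflect (forall i, i < size w ->
             addable (fun r => mu r + count_mem r (take i w)) (nth 0 w i))
          (lattice mu w).
Proof.
elim: w mu => [|r w IH] mu /=; first by apply: ReflectT.
apply: (iffP andP) => [[add_r /IH lw] [_|i /lw]|lw] /=.
- by rewrite /addable !addn0.
- by rewrite /addable /incr !(eq_sym r) !addnA.
split; first by have /= := lw 0 isT; rewrite /addable !addn0.
by apply/IH => i /(lw i.+1) /=; rewrite /addable /incr !(eq_sym r) !addnA.
Qed.

Lemma count_takeS (T : eqType) (x0 : T) (s : seq T) r i : i < size s ->
  count_mem r (take i.+1 s) = count_mem r (take i s) + (nth x0 s i == r).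
Proof. by move=> lti; rewrite (take_nth x0) // -cats1 count_cat /= addn0. Qed.

Lemma leq_count_take (T : eqType) (s : seq T) r i j : i <= j ->
  count_mem r (take i s) <= count_mem r (take j s).
Proof.
move=> leij; rewrite -(cat_take_drop i (take j s)) take_takel // count_cat.
exact: leq_addr.
Qed.

Lemma ltn_count_take (T : eqType) (x0 : T) (s : seq T) u v : u < v -> u < size s ->
  count_mem (nth x0 s u) (take u s) < count_mem (nth x0 s u) (take v s).
Proof.
move=> ltuv ltu; apply: leq_trans (leq_count_take s _ ltuv).
by rewrite (count_takeS x0) // eqxx addn1.
Qed.

(** A discrete intermediate value property: the count rises by at most one per letter, so it leaves
    the value [j] at some letter [r]. *)
Lemma count_take_ivt (T : eqType) (x0 : T) (s : seq T) r v j :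
  j < count_mem r (take v s) -> v <= size s ->
  exists u, [/\ u < v, nth x0 s u = r & count_mem r (take u s) = j].
Proof.
elim: v => [|v IH]; first by rewrite take0.
move=> ltj ltv; move: ltj; rewrite (count_takeS x0) //.
have [/IH h _|lej] := ltnP j (count_mem r (take v s)).
  by have [u [? ? ?]] := h (ltnW ltv); exists u; split=> //; apply: ltnW.
case: eqP => [rE|_]; last by lia.
by move=> ltj; exists v; split=> //; lia.
Qed.

(** * The bijection between standard tableaux and lattice words *)

Definition rows n (pos : {ffun 'I_n -> cell n}) : n.-tuple 'I_n := [tuple (pos v).1 | v < n].

Lemma nth_rows n (pos : {ffun 'I_n -> cell n}) (v : 'I_n) :
  nth 0 (map val (rows pos)) v = (pos v).1.
Proof. by rewrite (nth_map v) ?size_tuple // -tnth_nth tnth_mktuple. Qed.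

Lemma size_rows n (pos : {ffun 'I_n -> cell n}) : size (map val (rows pos)) = n.
Proof. by rewrite size_map size_tuple. Qed.

(** The number of earlier occurrences of the letter at [i]; it will be the column of entry [i]. *)
Definition rank (s : seq nat) i := count_mem (nth 0 s i) (take i s).

Section FromSYT.
Variables (n : nat) (pos : {ffun 'I_n -> cell n}).
Hypothesis pos_SYT : is_SYT pos.

Lemma SYT_inj : injective pos.
Proof. by case/andP: pos_SYT => /andP[/andP[/injectiveP]]. Qed.

Lemma SYT_closed (v : 'I_n) (i j : nat) : i <= (pos v).1 -> j <= (pos v).2 ->
  exists u : 'I_n, (pos u).1 = i :> nat /\ (pos u).2 = j :> nat.
Proof.
case/andP: pos_SYT => /andP[/andP[_ /forallP clos] _] _ lei lej.
have lti := leq_ltn_trans lei (ltn_ord _); have ltj := leq_ltn_trans lej (ltn_ord _).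
have /forallP/(_ (Ordinal lti, Ordinal ltj)) := clos v.
by rewrite /= lei lej => /codomP[u posu]; exists u; rewrite -posu.
Qed.

(** [is_SYT] compares adjacent cells only. Closure of the diagram fills a path from [u] to [v],
    first down and then right, along which entries increase. *)
Lemma SYT_mono (u v : 'I_n) : (pos u).1 <= (pos v).1 -> (pos u).2 <= (pos v).2 -> u <= v.
Proof.
case/andP: pos_SYT => /andP[_ /forallP rowP] /forallP colP.
have [d] := ubnP (((pos v).1 - (pos u).1) + ((pos v).2 - (pos u).2)).
elim: d u => // d IH u ltd le1 le2.
have [lt1|ge1] := ltnP (pos u).1 (pos v).1.
  have [u' [u'1 u'2]] := SYT_closed lt1 le2.
  have := forallP (colP u) u'; rewrite -!val_eqE /= u'1 u'2 !eqxx /= => ltu.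
  by apply: leq_trans (ltnW ltu) (IH _ _ _ _); lia.
have [lt2|ge2] := ltnP (pos u).2 (pos v).2.
  have [u' [u'1 u'2]] := SYT_closed le1 lt2.
  have := forallP (rowP u) u'; rewrite -!val_eqE /= u'1 u'2 !eqxx /= => ltu.
  by apply: leq_trans (ltnW ltu) (IH _ _ _ _); lia.
suff -> : u = v by [].
apply: SYT_inj; case: (pos u) (pos v) le1 le2 ge1 ge2 => [a b] [a' b'] /= *.
by congr (_, _); apply: val_inj => /=; lia.
Qed.

(** Strong induction on [v]. If the column is below the rank, an earlier entry of the row already
    has that column, against injectivity. If it is above, the cell whose column is the rank of [v]
    holds an earlier entry of the same rank, yet ranks strictly increase along a row. *)
Lemma SYT_col (v : 'I_n) : (pos v).2 = rank (map val (rows pos)) v :> nat.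
Proof.
have [m] := ubnP (val v); elim: m v => // m IH v ltvm.
rewrite /rank nth_rows; set j := count_mem _ _.
have [ltj|ltj|//] := ltngtP (pos v).2 j.
  have [|u [ltuv rowu colu]] := count_take_ivt 0 ltj; first by rewrite size_rows ltnW.
  have ltun : u < n by apply: ltn_trans ltuv _.
  have := nth_rows pos (Ordinal ltun); rewrite /= rowu => row_eq.
  have col_eq : (pos (Ordinal ltun)).2 = (pos v).2 :> nat.
    by rewrite IH /rank /= ?rowu ?colu //; apply: leq_trans ltuv _.
  suff /(congr1 val) /= uv : Ordinal ltun = v by move: ltuv; rewrite uv ltnn.
  apply: SYT_inj; rewrite [pos _]surjective_pairing [pos v]surjective_pairing.
  by congr (_, _); apply: val_inj; rewrite /= -?row_eq ?col_eq.
have [u [rowu colu]] := SYT_closed (leqnn (pos v).1) (ltnW ltj).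
have leuv : u <= v by apply: SYT_mono; rewrite ?rowu ?colu // ltnW.
have ltuv : u < v.
  by rewrite ltn_neqAle leuv andbT; apply: contraTneq ltj => /val_inj <-; rewrite colu ltnn.
have := @ltn_count_take _ 0 (map val (rows pos)) u v ltuv.
rewrite size_rows ltn_ord nth_rows rowu -/j => /(_ isT).
have := IH u; rewrite /rank nth_rows rowu colu => <-; last exact: leq_trans ltuv _.
by rewrite ltnn.
Qed.

(** The cell above [v] holds an earlier [u] in the same column, so by [SYT_col] row [r] has strictly
    more entries before [v] than row [r.+1]. *)
Lemma lattice_rows : lattice (fun=> 0) (map val (rows pos)).
Proof.
apply/latticeP => i; rewrite size_rows => ltin.
have -> : i = Ordinal ltin by []; move: (Ordinal ltin) => {i ltin}v.
rewrite nth_rows /addable !add0n.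
case def_r: (val (pos v).1) => [|r] //=.
have [||u [rowu colu]] := @SYT_closed v r (pos v).2; [by rewrite [leqRHS]def_r | exact: leqnn | ].
have ltuv : u < v.
  rewrite ltn_neqAle SYT_mono ?rowu ?colu ?def_r // andbT.
  by apply: contra_eq_neq rowu => /val_inj ->; rewrite def_r; lia.
have := @ltn_count_take _ 0 (map val (rows pos)) u v ltuv.
rewrite size_rows ltn_ord nth_rows rowu => /(_ isT).
have := SYT_col u; have := SYT_col v; rewrite /rank !nth_rows rowu colu /= def_r => -> <-.
by [].
Qed.

End FromSYT.

Lemma rows_inj n : {in [pred pos | @is_SYT n pos] &, injective (@rows n)}.
Proof.
move=> p q; rewrite !inE => pS qS pq; apply/ffunP => v.
rewrite [p v]surjective_pairing [q v]surjective_pairing.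
by congr (_, _); apply: val_inj => /=; rewrite -?nth_rows ?SYT_col // pq.
Qed.

Section FromWord.
Variables (n : nat) (w : n.-tuple 'I_n).
Let s := map val w.
Hypothesis lat_w : lattice (fun=> 0) s.

Lemma rank_lt (v : 'I_n) : rank s v < n.
Proof.
apply: leq_ltn_trans (count_size _ _) _; rewrite size_take size_map size_tuple.
by rewrite ltn_ord.
Qed.

Definition tableau : {ffun 'I_n -> cell n} := [ffun v => (tnth w v, Ordinal (rank_lt v))].

Lemma rows_tableau : rows tableau = w.
Proof. by apply: eq_from_tnth => v; rewrite tnth_mktuple ffunE. Qed.

Let size_s : size s = n. Proof. by rewrite size_map size_tuple. Qed.

Let tableau1 v : (tableau v).1 = nth 0 s v :> nat.
Proof. by rewrite -nth_rows rows_tableau. Qed.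

Let tableau2 v : (tableau v).2 = rank s v :> nat. Proof. by rewrite ffunE. Qed.

Lemma count_take_decr r v : v <= n -> count_mem r.+1 (take v s) <= count_mem r (take v s).
Proof.
elim: v => [|v IH] ltvn; first by rewrite take0.
rewrite !(count_takeS 0) ?size_s //; have := IH (ltnW ltvn).
have /latticeP/(_ v) := lat_w; rewrite size_s => /(_ ltvn).
rewrite /addable !add0n; case: eqP => [->|_] /=; first by case: eqP; lia.
by case: (eqVneq _ r.+1) => [->|_] /=; lia.
Qed.

Lemma count_take_antimono r r' v : v <= n -> r <= r' ->
  count_mem r' (take v s) <= count_mem r (take v s).
Proof.
move=> lev; elim: r' => [|r' IH]; first by rewrite leqn0 => /eqP->.
rewrite leq_eqVlt => /predU1P[->//|/IH]; apply: leq_trans; exact: count_take_decr.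
Qed.

Lemma tableau_SYT : is_SYT tableau.
Proof.
have lt_rank (a b : 'I_n) : nth 0 s a = nth 0 s b -> a < b -> rank s a < rank s b.
  by move=> rowE ltab; rewrite /rank -rowE; apply: ltn_count_take; rewrite ?size_s.
(* The cell [(i, j)] is filled by occurrence number [j], from 0, of the letter [i]. For a row above
   that of [v], the lattice condition at [v] puts this occurrence before [v]. *)
have cellP (v : 'I_n) i j : i <= nth 0 s v -> j <= rank s v ->
    exists2 u : 'I_n, nth 0 s u = i & rank s u = j.
  have ivt i' j' : j' < count_mem i' (take v s) ->
      exists2 u : 'I_n, nth 0 s u = i' & rank s u = j'.
    move=> /(count_take_ivt 0)[|u [ltuv rowu colu]]; first by rewrite size_s ltnW.
    by exists (Ordinal (ltn_trans ltuv (ltn_ord v))); rewrite /rank /= ?rowu.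
  rewrite leq_eqVlt => /predU1P[->|lti].
    by rewrite leq_eqVlt => /predU1P[->|/ivt//]; exists v.
  move=> lej; apply: ivt; apply: leq_ltn_trans lej _.
  have /latticeP/(_ v) := lat_w; rewrite size_s => /(_ (ltn_ord _)).
  rewrite /addable !add0n gtn_eqF /=; last by lia.
  by move/leq_trans; apply; apply: count_take_antimono; [apply: ltnW | lia].
do 3?[apply/andP; split].
- apply/injectiveP => a b tab.
  have := tableau1 a; have := tableau2 a; rewrite tab tableau1 tableau2 => rk rw.
  apply: val_inj; case: (ltngtP (val a) (val b)) => // lt_ab.
    by have := lt_rank _ _ (esym rw) lt_ab; rewrite rk ltnn.
  by have := lt_rank _ _ rw lt_ab; rewrite rk ltnn.
- apply/forallP => v; apply/forallP => -[i j] /=; apply/implyP => /andP[].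
  rewrite tableau1 tableau2 => lei lej.
  have [u rowu colu] := cellP v i j lei lej.
  apply/codomP; exists u; rewrite [tableau u]surjective_pairing.
  by congr (_, _); apply: val_inj; rewrite /= ?tableau1 ?tableau2.
- apply/forallP => a; apply/forallP => b; apply/implyP.
  rewrite -!val_eqE /= !tableau1 !tableau2 => /andP[/eqP rowE /eqP colE].
  rewrite ltnNge; apply/negP => leba; suff: rank s b <= rank s a by rewrite -colE ltnn.
  by rewrite /rank rowE; apply: leq_count_take.
- apply/forallP => a; apply/forallP => b; apply/implyP.
  rewrite -!val_eqE /= !tableau1 !tableau2 => /andP[/eqP colE /eqP rowE].
  (* If [b <= a], the upper row has at most [rank s a = rank s b] letters before [b], which
     contradicts the lattice condition at [b]. *)
  rewrite ltnNge; apply/negP => leba.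
  have /latticeP/(_ b) := lat_w; rewrite size_s => /(_ (ltn_ord _)).
  rewrite /addable !add0n -rowE /= ltnNge => /negP; apply.
  move: colE; rewrite /rank -rowE => <-; exact: leq_count_take.
Qed.

End FromWord.

(** Columns are ranks, so label [k.+1], at index [k], lies in cell [(0, 1)] exactly when letter [k]
    is the second 0 of the word. *)
Lemma fE n k : k < n ->
  f n k.+1 = #|words n n (fun=> 0) (fun w => (nth 0 w k == 0) && (count_mem 0 (take k w) == 1))|.
Proof.
move=> ltkn; rewrite /f -(card_in_imset (f := @rows n)); last first.
  by apply: sub_in2 (@rows_inj n) => p; rewrite !inE => /andP[].
have entryE (p : {ffun 'I_n -> cell n}) : is_SYT p -> entry12 k.+1 p =
    (nth 0 (map val (rows p)) k == 0) && (count_mem 0 (take k (map val (rows p))) == 1).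
  move=> pS; apply/existsP/andP => [[v /and3P[row0 col1 /eqP[<-]]]|[row0 col1]].
    rewrite nth_rows row0; split=> //; move: col1.
    by rewrite /= SYT_col // /rank nth_rows (eqP row0).
  exists (Ordinal ltkn); rewrite /= eqxx andbT SYT_col // /rank -nth_rows /=.
  by rewrite row0 (eqP row0).
apply: eq_card => w; rewrite inE; apply/imsetP/andP => [[p]|[lw Pw]].
  by rewrite inE => /andP[pS pk] ->; rewrite lattice_rows // -entryE.
exists (tableau w); last by rewrite rows_tableau.
by rewrite inE tableau_SYT // entryE ?tableau_SYT ?rows_tableau.
Qed.

(** * Counting words by the position of the second 0 *)

Lemma card_words_all B N mu : #|words B N mu xpredT| = growths B N mu.
Proof.
elim: N mu => [|N IH] mu.
  rewrite (eq_card (B := predT)) ?card_tuple ?expn0 // => w.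
  by rewrite inE tuple0.
by rewrite card_wordsS; apply: eq_bigr => r _; rewrite IH.
Qed.

Lemma addable_column m r : addable (column m.+1) r = (r == 0) || (r == m.+1).
Proof. by rewrite /addable /column; lia. Qed.

Lemma incr_column m : incr (column m) m =1 column m.+1.
Proof. by move=> s; rewrite /incr /column; lia. Qed.

(** A nonempty column grows only in row 0 or at its bottom, so avoiding 0 forces [k] steps down;
    then comes the 0, and the last [N] letters are free. *)
Lemma card_words_second_column B N m k : m.+1 + k <= B ->
  #|words B (k.+1 + N) (column m.+1) (fun w => (nth 0 w k == 0) && (0 \notin take k w))| =
  growths B N (incr (column (m.+1 + k)) 0).
Proof.
have eq_words0 B' N' mu (P : pred (seq nat)) : P =1 xpred0 -> #|words B' N' mu P| = 0.
  by move=> P0; apply: eq_card0 => w; rewrite inE P0 andbF.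
elim: k m => [|k IH] m leB; rewrite addSn card_wordsS.
  rewrite (bigD1 (Ordinal (leq_trans (ltn0Sn _) leB : 0 < B))) ?addable_column //=.
  rewrite big1 => [|r /andP[_ r0]]; last first.
    by apply: eq_words0 => w /=; apply/negbTE; rewrite andbT; apply: contra r0.
  by rewrite !addn0 add0n -card_words_all; congr #|pred_of_set _|; apply: eq_words => // w.
have ltmB : m.+1 < B by lia.
rewrite (bigD1 (Ordinal ltmB)) ?addable_column ?eqxx ?orbT //=.
rewrite big1 => [|r /andP[]]; last first.
  rewrite addable_column => /orP[/eqP r0 _|rm]; last by rewrite -val_eqE /= rm.
  by apply: eq_words0 => w /=; rewrite r0 inE eqxx andbF.
rewrite addn0 -addSnnS -IH; last by lia.
by congr #|pred_of_set _|; apply: eq_words; [exact: incr_column | move=> w /=].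
Qed.

Lemma f1E n : 0 < n -> f n 1 = 0.
Proof. by move=> n0; rewrite fE //; apply: eq_card0 => w; rewrite inE take0 !andbF. Qed.

(** The first letter is forced to be 0. It is the single 0 allowed before the marked one, so the
    next [k] letters avoid 0. *)
Lemma fSSE N k : f (N + k.+2) k.+2 = growths (N + k.+2) N (incr (column k.+1) 0).
Proof.
rewrite fE; last by lia.
set B := N + k.+2; rewrite -[k.+1]add1n -card_words_second_column; last by rewrite /B; lia.
have -> : B = (k.+1 + N).+1 by rewrite /B; lia.
rewrite card_wordsS (bigD1 ord0) //= big1 => [|r /andP[]]; last by case: r => -[].
rewrite addn0; congr #|pred_of_set _|; apply: eq_words => [s|w /=].
  by rewrite /incr /column; lia.
by rewrite add1n eqSS -has_pred1 has_count -eqn0Ngt.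
Qed.

Lemma growths_column_split B N m : m.+1 < B ->
  growths B N.+1 (column m.+1) =
    growths B N (column m.+2) + growths B N (incr (column m.+1) 0).
Proof.
move=> ltmB /=; have B0 : 0 < B by lia.
rewrite (bigD1 (Ordinal ltmB)) ?addable_column ?eqxx ?orbT //=.
rewrite (bigD1 (Ordinal B0)) ?addable_column //= big1 => [|r]; last first.
  by rewrite addable_column -!val_eqE /=; lia.
by rewrite addn0; congr (_ + _); apply: eq_growths; apply: incr_column.
Qed.

Lemma f_diff N k : f (N + k.+1) k.+1 + \sum_(a < k.+2) 'C(N, a) * invol (N - a) =
  \sum_(a < k.+1) 'C(N.+1, a) * invol (N.+1 - a).
Proof.
case: k => [|k].
  (* The empty column has a single upper neighbour, so this case is separate: it reduces to
     [involS]. *)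
  rewrite f1E; last by lia.
  by rewrite !big_ord_recl !big_ord0 /= !bin0 bin1 !subn0 involS subn1 !mul1n !addn0.
rewrite fSSE -!(@growths_columnE (N + k.+2)); [|lia|lia].
by rewrite growths_column_split ?(addnC (growths _ _ (incr _ _))) //; lia.
Qed.

(** After Pascal's rule the two sums of ['C(N, a) * invol (N - a)] cancel except for the terms
    [a = k] and [a = k.+1]. *)
Lemma f_closed N k : f (N + k.+1) k.+1
    + 'C(N, k) * invol (N - k) + 'C(N, k.+1) * invol (N - k.+1) =
  \sum_(a < k.+1) 'C(N, a) * invol (N.+1 - a).
Proof.
have := f_diff N k; rewrite sum_bin_invol_pascal.
by rewrite [\sum_(a < k.+2) _]big_ord_recr [\sum_(a < k.+1) _ * invol (N - _)]big_ord_recr /=; lia.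
Qed.

(** * Passage to integer indices *)

Local Open Scope ring_scope.

(* The binomial vanishes when the truncated [N + e - a] differs from the integer one. *)
Lemma binz_t N a (e : bool) :
  binz N%:Z a%:Z * t (N%:Z - a%:Z + e%:Z) = ('C(N, a) * invol (N + e - a))%N%:Z.
Proof.
have [leaN|ltNa] := leqP a N; last by rewrite /= bin_small // mul0r.
have -> : N%:Z - a%:Z + e%:Z = (N + e - a)%N%:Z by lia.
by rewrite PoszM.
Qed.

Theorem theorem3 (n k : nat) (hk1 : (1 <= k)%N) (hkn : (k <= n)%N) :
  (f n k)%:Z =
    \sum_(0 <= j < k)
       binz (n%:Z - k%:Z) (k%:Z - j%:Z - 1) * t (n%:Z - 2 * k%:Z + j%:Z + 2)
    - binz (n%:Z - k%:Z) (k%:Z - 1) * t (n%:Z - 2 * k%:Z + 1)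
    - binz (n%:Z - k%:Z) k%:Z * t (n%:Z - 2 * k%:Z).
Proof.
have [N defn] : exists N, n = (N + k)%N by exists (n - k)%N; rewrite subnK.
case: k hk1 hkn defn => // k _ _ ->; have := f_closed N k.
have -> : (N + k.+1)%N%:Z - k.+1%:Z = N%:Z by lia.
have -> : k.+1%:Z - 1 = k%:Z by lia.
have -> : (N + k.+1)%N%:Z - 2 * k.+1%:Z + 1 = N%:Z - k%:Z + false%:Z by lia.
have -> : (N + k.+1)%N%:Z - 2 * k.+1%:Z = N%:Z - k.+1%:Z + false%:Z by lia.
rewrite !binz_t addn0 => fE.
have -> : \sum_(0 <= j < k.+1) binz N%:Z (k.+1%:Z - j%:Z - 1)
     * t (N%:Z - k.+1%:Z + false%:Z + j%:Z + 2) =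
   (\sum_(a < k.+1) 'C(N, a) * invol (N.+1 - a))%N%:Z.
  (* The reversal [j = k - a] turns the lower binomial index into [a] and the index of [t] into
     [N - a + 1]. *)
  rewrite big_nat_rev big_mkord -[RHS]natz natr_sum.
  apply: eq_bigr => a _; rewrite add0n [RHS]natz -[N.+1]addn1 -(binz_t N a true).
  by congr (binz _ _ * t _); have := ltn_ord a; lia.
lia.
Qed.
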